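(* Let $Q$ be the $5\times 5$ permutation matrix whose $1$ entries are exactly at positions (row, column) $(1,2),(2,5),(3,3),(4,1),(5,4)$. Then $sat(Q,n)<400$ for every positive integer $n$.
   Context: All matrices are $0$-$1$ matrices; an $m\times n$ matrix has $m$ rows and $n$ columns. The weight of a matrix is its number of $1$ entries. A matrix $M$ contains a $k\times l$ pattern $P$ if there are rows $r_1<\dots<r_k$ and columns $c_1<\dots<c_l$ of $M$ such that $M(r_a,c_b)=1$ whenever $P(a,b)=1$; otherwise $M$ avoids $P$. A matrix $M$ is saturating for $P$ if $M$ avoids $P$ and changing any single $0$ entry of $M$ to $1$ yields a matrix containing $P$. $sat(P,m,n)$ is the minimum weight of an $m\times n$ matrix saturating for $P$, and $sat(P,n)=sat(P,n,n)$. *)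

(* Defs.v *)
From mathcomp Require Import all_boot all_order all_algebra.

Set Implicit Arguments.
Unset Strict Implicit.
Unset Printing Implicit Defensive.

(* 0-1 matrices are matrices over bool; indices are 0-based. *)

Definition weight m n (M : 'M[bool]_(m, n)) : nat :=
  #|[set ij : 'I_m * 'I_n | M ij.1 ij.2]|.

Definition increasing k m (f : {ffun 'I_k -> 'I_m}) : bool :=
  [forall a : 'I_k, forall b : 'I_k, (a < b) ==> (f a < f b)].

Definition contains k l m n (P : 'M[bool]_(k, l)) (M : 'M[bool]_(m, n)) : bool :=
  [exists r : {ffun 'I_k -> 'I_m}, exists c : {ffun 'I_l -> 'I_n},
     [&& increasing r, increasing c &
         [forall a : 'I_k, forall b : 'I_l, P a b ==> M (r a) (c b)]]].

Definition avoids k l m n (P : 'M[bool]_(k, l)) (M : 'M[bool]_(m, n)) : bool :=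
  ~~ contains P M.

Definition set_entry m n (M : 'M[bool]_(m, n)) (i : 'I_m) (j : 'I_n) :
    'M[bool]_(m, n) :=
  \matrix_(a, b) (((a == i) && (b == j)) || M a b).

Definition saturating k l m n (P : 'M[bool]_(k, l)) (M : 'M[bool]_(m, n)) : bool :=
  avoids P M &&
  [forall i : 'I_m, forall j : 'I_n, ~~ M i j ==> contains P (set_entry M i j)].

(* The default (m * n).+1 exceeds the weight of every m x n matrix, so it is
   the value only when no saturating matrix exists. By [saturating_exists]
   this does not happen when P has a 1 entry; then [sat_minimum] applies. *)
Definition sat k l (P : 'M[bool]_(k, l)) (m n : nat) : nat :=
  \big[minn/(m * n).+1]_(M : 'M[bool]_(m, n) | saturating P M) weight M.

Definition Q : 'M[bool]_(5, 5) :=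
  \matrix_(i < 5, j < 5)
    ((i.+1, j.+1) \in [:: (1, 2); (2, 5); (3, 3); (4, 1); (5, 4)]).

Lemma weight_le m n (M : 'M[bool]_(m, n)) : weight M <= m * n.
Proof. by rewrite (leq_trans (max_card _)) // card_prod !card_ord. Qed.

Lemma sat_minimum k l (P : 'M[bool]_(k, l)) m n :
  (exists M : 'M[bool]_(m, n), saturating P M) ->
  (exists2 M : 'M[bool]_(m, n), saturating P M & weight M = sat P m n) /\
  (forall M : 'M[bool]_(m, n), saturating P M -> sat P m n <= weight M).
Proof.
have lb (M : 'M[bool]_(m, n)) : saturating P M -> sat P m n <= weight M.
  move=> sM; rewrite /sat; have: M \in index_enum _ by rewrite mem_index_enum.
  elim: (index_enum _) => // N s IHs; rewrite inE big_cons => /orP[/eqP<-|Ms].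
    by rewrite sM geq_minl.
  by case: ifP => _; rewrite ?geq_min IHs ?orbT.
move=> [M0 sM0]; split=> //.
have : sat P m n = (m * n).+1 \/
       exists2 M : 'M[bool]_(m, n), saturating P M & weight M = sat P m n.
  rewrite /sat; apply: (big_ind (fun s => s = (m * n).+1 \/
    exists2 M : 'M[bool]_(m, n), saturating P M & weight M = s)).
  - by left.
  - by move=> x y Hx Hy; rewrite /minn; case: ifP.
  - by move=> M sM; right; exists M.
case=> // e; have := leq_trans (lb _ sM0) (weight_le M0).
by rewrite e ltnn.
Qed.

Lemma saturating_exists k l (P : 'M[bool]_(k, l)) m n :
  (exists a b, P a b) -> exists M : 'M[bool]_(m, n), saturating P M.
Proof.
move=> [a [b Pab]].
have av0 : avoids P (const_mx false : 'M[bool]_(m, n)).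
  apply/negP=> /existsP[r /existsP[c /and3P[_ _ /forallP/(_ a)/forallP/(_ b)]]].
  by rewrite Pab mxE.
case: (@arg_maxnP _ (const_mx false : 'M[bool]_(m, n)) (avoids P) (@weight m n) av0).
move=> M avM maxM; exists M; rewrite /saturating avM /=.
apply/forallP=> i; apply/forallP=> j; apply/implyP=> Mij.
case: (boolP (contains P (set_entry M i j))) => // avM'; have := maxM _ avM'.
rewrite /geq /= leqNgt => /negP; case; apply: proper_card; apply/properP; split.
  by apply/subsetP=> x; rewrite !inE mxE => ->; rewrite orbT.
by exists (i, j); rewrite !inE ?mxE ?eqxx //= (negbTE Mij).
Qed.

(* Main.v *)
Require Import Defs.
From mathcomp Require Import all_boot all_order all_algebra.
From mathcomp Require Import zify.

Set Implicit Arguments.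
Unset Strict Implicit.
Unset Printing Implicit Defensive.

(** Let [W] avoid a pattern [P] that has no empty row or column, and suppose
    that setting any entry of row [e] or column [f] of [W] to 1 creates a copy
    of [P]; in particular row [e] and column [f] are empty. Replacing that row
    and that column by arbitrarily many copies of themselves preserves both
    properties. Now extend the resulting matrix to a maximal one avoiding [P]:
    it is saturating, and all its 1 entries lie outside the duplicated rows and
    columns, so its weight is bounded in terms of the dimensions of [W] only.
    For [Q], a 9 x 9 matrix [W] with twelve 1 entries does the job, as a
    backtracking search for copies of [Q] confirms. *)

Section OnesAndContainment.

Variables m n : nat.
Implicit Types (M N : 'M[bool]_(m, n)) (i : 'I_m) (j : 'I_n).

Definition ones M : {set 'I_m * 'I_n} := [set ij | M ij.1 ij.2].

Definition entrywise_le M N : bool := ones M \subset ones N.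

Lemma entrywise_leP M N :
  reflect (forall i j, M i j -> N i j) (entrywise_le M N).
Proof.
apply: (iffP subsetP) => [MN i j Mij|MN [i j]]; last by rewrite !inE => /MN.
by have := MN (i, j); rewrite !inE; apply.
Qed.

Lemma entrywise_le_set_entry M i j : entrywise_le M (set_entry M i j).
Proof. by apply/entrywise_leP=> a b; rewrite mxE orbC => ->. Qed.

Lemma set_entry_entrywise_le M N i j :
  entrywise_le M N -> N i j -> entrywise_le (set_entry M i j) N.
Proof.
move=> /entrywise_leP MN Nij; apply/entrywise_leP=> a b; rewrite mxE.
by case/orP=> [/andP[/eqP-> /eqP->]|/MN].
Qed.

Lemma ltn_weight_set_entry M i j :
  ~~ M i j -> weight M < weight (set_entry M i j).
Proof.
move=> Mij; apply: proper_card; apply/andP; split.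
  exact: entrywise_le_set_entry.
by apply/subsetPn; exists (i, j); rewrite !inE ?mxE ?eqxx.
Qed.

Variables (k l : nat) (P : 'M[bool]_(k, l)).

Lemma containsP M :
  reflect (exists (r : 'I_k -> 'I_m) (c : 'I_l -> 'I_n),
             [/\ {homo r : a b / a < b}, {homo c : a b / a < b} &
                 forall a b, P a b -> M (r a) (c b)])
          (contains P M).
Proof.
apply: (iffP existsP) => [[r /existsP[c]]|[r [c [incr incc PM]]]].
  case/and3P=> /'forall_'forall_implyP incr /'forall_'forall_implyP incc.
  by move=> /'forall_'forall_implyP PM; exists r, c.
exists (finfun r); apply/existsP; exists (finfun c); apply/and3P.
by split; apply/'forall_'forall_implyP=> a b; rewrite !ffunE;
  [apply: incr | apply: incc | apply: PM].
Qed.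

Lemma contains_entrywise_le M N :
  entrywise_le M N -> contains P M -> contains P N.
Proof.
move=> /entrywise_leP MN /containsP[r [c [incr incc PM]]]; apply/containsP.
by exists r, c; split=> // a b /PM /MN.
Qed.

Lemma avoids_entry0 M N i j :
  entrywise_le N M -> avoids P M -> contains P (set_entry N i j) -> ~~ M i j.
Proof.
move=> NM avM PN; apply: contra avM => Mij.
exact: contains_entrywise_le (set_entry_entrywise_le NM Mij) PN.
Qed.

Lemma avoids_extend_saturating N :
  avoids P N -> exists2 M, saturating P M & entrywise_le N M.
Proof.
move=> avN; pose above M := avoids P M && entrywise_le N M.
have aboveN : above N by rewrite /above avN; apply/entrywise_leP.
case: (@arg_maxnP _ N above (@weight m n) aboveN) => M /andP[avM NM] maxM.
exists M => //; rewrite /saturating avM.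
apply/'forall_'forall_implyP=> i j /ltn_weight_set_entry; apply: contraLR.
move=> avMij; rewrite -leqNgt; apply: maxM; rewrite /above [avoids _ _]avMij.
exact: subset_trans NM (entrywise_le_set_entry M i j).
Qed.

Lemma sat_le_weight M : saturating P M -> sat P m n <= weight M.
Proof. by move=> satM; have [_] := sat_minimum (ex_intro _ M satM); apply. Qed.

Lemma sat_le_area : (exists a b, P a b) -> sat P m n <= m * n.
Proof.
move=> /(saturating_exists m n)[M satM].
exact: leq_trans (sat_le_weight satM) (weight_le M).
Qed.

End OnesAndContainment.

Section Collapse.

Variables (p d : nat) (e : 'I_p).
Implicit Types (i j : 'I_(p + d)) (a b : 'I_p).

Lemma collapse_subproof i : maxn (minn i e) (i - d) < p.
Proof. by have := ltn_ord i; have := ltn_ord e; lia. Qed.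

(* Merges the d + 1 consecutive indices starting at e. *)
Definition collapse i : 'I_p := Ordinal (collapse_subproof i).

Lemma ltn_collapse i j :
  collapse i != e -> (collapse i < collapse j) = (i < j).
Proof. by rewrite -val_eqE /=; lia. Qed.

Lemma collapse_inj i j :
  collapse i != e -> collapse i = collapse j -> i = j.
Proof.
move=> ine ij; have jne : collapse j != e by rewrite -ij.
have := ltn_collapse j ine; have := ltn_collapse i jne.
by rewrite ij ltnn => ji ij0; apply: ord_inj; lia.
Qed.

Lemma leq_card_collapse_neq : #|[set i | collapse i != e]| <= p.-1.
Proof.
rewrite -(@card_in_imset _ _ collapse); last first.
  by move=> i j; rewrite inE => ine _; apply: collapse_inj.
have := cardsC1 e; rewrite card_ord => <-; apply: subset_leq_card.
by apply/subsetP=> _ /imsetP[i + ->]; rewrite !inE.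
Qed.

Lemma collapse_section_subproof i a :
  a + (if a < e then 0 else if e < a then d else minn (i - e) d) < p + d.
Proof. by have := ltn_ord a; do ?case: ifP; lia. Qed.

Definition collapse_section i a : 'I_(p + d) :=
  Ordinal (collapse_section_subproof i a).

Lemma collapse_section_homo i : {homo collapse_section i : a b / a < b}.
Proof. by move=> a b /=; do ?case: ifP; lia. Qed.

Lemma collapse_sectionK i : cancel (collapse_section i) collapse.
Proof. by move=> a; apply: ord_inj => /=; do ?case: ifP; lia. Qed.

Lemma collapse_section_collapse i : collapse_section i (collapse i) = i.
Proof. by apply: ord_inj => /=; do ?case: ifP; lia. Qed.

End Collapse.

Definition no_empty_line k l (P : 'M[bool]_(k, l)) : Prop :=
  (forall a, exists b, P a b) /\ (forall b, exists a, P a b).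

(* An expandable row (column) of a matrix avoiding P is necessarily empty. *)
Definition expandable_row k l m n (P : 'M[bool]_(k, l)) (W : 'M[bool]_(m, n))
    (e : 'I_m) : Prop :=
  forall j, contains P (set_entry W e j).

Definition expandable_col k l m n (P : 'M[bool]_(k, l)) (W : 'M[bool]_(m, n))
    (f : 'I_n) : Prop :=
  forall i, contains P (set_entry W i f).

Definition witness k l m n (P : 'M[bool]_(k, l)) (W : 'M[bool]_(m, n))
    (e : 'I_m) (f : 'I_n) : Prop :=
  [/\ avoids P W, expandable_row P W e & expandable_col P W f].

Section Inflate.

Variables (k l p q : nat) (P : 'M[bool]_(k, l)) (W : 'M[bool]_(p, q)).
Variables (e : 'I_p) (f : 'I_q).

Definition inflate d1 d2 : 'M[bool]_(p + d1, q + d2) :=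
  mxsub (@collapse p d1 e) (@collapse q d2 f) W.

Lemma contains_inflate d1 d2 :
  no_empty_line P -> (forall j, ~~ W e j) -> (forall i, ~~ W i f) ->
  contains P (inflate d1 d2) -> contains P W.
Proof.
move=> [rowP colP] We0 Wf0 /containsP[r [c [incr incc PW]]].
have {}PW a b : P a b -> W (collapse e (r a)) (collapse f (c b)).
  by move/PW; rewrite mxE.
apply/containsP; exists (collapse e \o r), (collapse f \o c).
split=> [a a' /incr|b b' /incc|//] /=.
- have [b /PW Wab] := rowP a; rewrite ltn_collapse //.
  by apply: contraTneq Wab => ->.
- have [a /PW Wab] := colP b; rewrite ltn_collapse //.
  by apply: contraTneq Wab => ->.
Qed.

Lemma contains_set_entry_inflate d1 d2 (i : 'I_(p + d1)) (j : 'I_(q + d2)) :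
  contains P (set_entry W (collapse e i) (collapse f j)) ->
  contains P (set_entry (inflate d1 d2) i j).
Proof.
move=> /containsP[r [c [incr incc PW]]]; apply/containsP.
exists (collapse_section e i \o r), (collapse_section f j \o c).
split=> [a a' /incr|b b' /incc|a b /PW] /=; try exact: collapse_section_homo.
rewrite !mxE !collapse_sectionK => /orP[/andP[/eqP-> /eqP->]|->].
  by rewrite !collapse_section_collapse !eqxx.
by rewrite orbT.
Qed.

Lemma avoids_inflate d1 d2 :
  no_empty_line P -> witness P W e f -> avoids P (inflate d1 d2).
Proof.
move=> neP [avW expe expf]; apply: contra (avW).
apply: contains_inflate => // [j|i].
- exact: avoids_entry0 (subxx _) avW (expe j).
- exact: avoids_entry0 (subxx _) avW (expf i).
Qed.

Lemma sat_le_witness m n :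
  no_empty_line P -> witness P W e f -> p <= m -> q <= n ->
  sat P m n <= p.-1 * q.-1.
Proof.
move=> neP witW /subnKC<- /subnKC<-; have [_ expe expf] := witW.
set d1 := m - p; set d2 := n - q.
have [M satM NM] := avoids_extend_saturating (avoids_inflate d1 d2 neP witW).
have /andP[avM _] := satM.
have M_support i j : M i j -> (collapse e i != e) && (collapse f j != f).
  rewrite -negb_or; apply: contraL => ef; apply: avoids_entry0 NM avM _.
  by apply: contains_set_entry_inflate; case/orP: ef => /eqP->.
apply: leq_trans (sat_le_weight satM) _.
apply: leq_trans _ (leq_mul (leq_card_collapse_neq d1 e)
                            (leq_card_collapse_neq d2 f)).
rewrite -cardsX; apply: subset_leq_card; apply/subsetP=> -[i j].
by rewrite !inE; apply: M_support.
Qed.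

End Inflate.

Local Notation cell := (nat * nat)%type.

Definition ones_mx m n (s : seq cell) : 'M[bool]_(m, n) :=
  \matrix_(i, j) ((i : nat, j : nat) \in s).

Lemma set_entry_ones_mx m n s (i : 'I_m) (j : 'I_n) :
  set_entry (ones_mx m n s) i j = ones_mx m n ((i : nat, j : nat) :: s).
Proof. by apply/matrixP=> a b; rewrite !mxE inE xpair_eqE. Qed.

Definition in_grid m n (s : seq cell) : bool :=
  all (fun x => (x.1 < m) && (x.2 < n)) s.

Lemma in_grid_ordinals m n s x :
  in_grid m n s -> x \in s ->
  exists (i : 'I_m) (j : 'I_n), x = (i : nat, j : nat).
Proof.
move=> /allP sP /sP /andP[x1m x2n]; exists (Ordinal x1m), (Ordinal x2n).
by case: x x1m x2n.
Qed.

Lemma increasing_mono m n (r : 'I_m -> 'I_n) :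
  {homo r : i j / i < j} -> {mono r : i j / i < j}.
Proof.
move=> incr i j; case: (ltngtP i j) => [/incr //|/incr|/ord_inj->].
- by lia.
- exact: ltnn.
Qed.

Definition same_order (u v : nat * nat) : bool :=
  ((u.1 < v.1) == (u.2 < v.2)) && ((v.1 < u.1) == (v.2 < u.2)).

Lemma increasing_interpolation m n (s : seq (nat * nat)) :
  {subset iota 0 m <= unzip1 s} -> {in unzip2 s, forall x, x < n} ->
  all2rel same_order s ->
  exists2 r : 'I_m -> 'I_n, {homo r : i j / i < j} &
    forall i x, (nat_of_ord i, x) \in s -> r i = x :> nat.
Proof.
move=> s_m s_n /allrelP ords.
have /fin_all_exists[r rs] (i : 'I_m) :
    exists x : 'I_n, (i : nat, x : nat) \in s.
  have /s_m/mapP[[i' x] ixs /= ->] : (i : nat) \in iota 0 m.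
    by rewrite mem_iota /=.
  by exists (Ordinal (s_n x (map_f _ ixs))).
exists r => [i j ij|i x ixs].
- by have := ords _ _ (rs i) (rs j); rewrite /same_order /=; lia.
- by have := ords _ _ ixs (rs i); rewrite /same_order /=; lia.
Qed.

(* Each pair is (cell of the pattern, cell it is mapped to). *)
Local Notation placement := (seq (cell * cell)).

Definition row_placement (G : placement) : seq (nat * nat) :=
  [seq (u.1.1, u.2.1) | u <- G].

Definition col_placement (G : placement) : seq (nat * nat) :=
  [seq (u.1.2, u.2.2) | u <- G].

Definition consistent (G : placement) : bool :=
  all2rel same_order (row_placement G) && all2rel same_order (col_placement G).

Lemma consistent_catl G H : consistent (G ++ H) -> consistent G.
Proof.
by rewrite /consistent /row_placement /col_placement !map_cat !allrel_catl
  !allrel_catr => /andP[/andP[/andP[-> _] _] /andP[/andP[-> _] _]].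
Qed.

Definition spans_grid k l (ps : seq cell) : bool :=
  [&& in_grid k l ps, all [in unzip1 ps] (iota 0 k) &
      all [in unzip2 ps] (iota 0 l)].

Section Placements.

Variables (k l m n : nat) (ps s : seq cell).

Lemma no_empty_line_ones_mx :
  spans_grid k l ps -> no_empty_line (ones_mx k l ps).
Proof.
case/and3P=> ps_kl /allP rowP /allP colP; split=> i.
- have /rowP/mapP[x xps iE] : (i : nat) \in iota 0 k by rewrite mem_iota /=.
  have [a [b xE]] := in_grid_ordinals ps_kl xps.
  by exists b; rewrite mxE iE xE -xE.
- have /colP/mapP[x xps iE] : (i : nat) \in iota 0 l by rewrite mem_iota /=.
  have [a [b xE]] := in_grid_ordinals ps_kl xps.
  by exists a; rewrite mxE iE xE -xE.
Qed.

Lemma placement_of_contains :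
  in_grid k l ps -> contains (ones_mx k l ps) (ones_mx m n s) ->
  exists G, [/\ unzip1 G = ps, {subset unzip2 G <= s} & consistent G].
Proof.
move=> ps_kl /containsP[r [c [/increasing_mono incr /increasing_mono incc PM]]].
pose r_nat i := oapp (fun i => r i : nat) 0 (insub i).
pose c_nat j := oapp (fun j => c j : nat) 0 (insub j).
have r_natE (i : 'I_k) : r_nat i = r i by rewrite /r_nat valK.
have c_natE (j : 'I_l) : c_nat j = c j by rewrite /c_nat valK.
exists [seq (a, (r_nat a.1, c_nat a.2)) | a <- ps]; split.
- by rewrite /unzip1 -map_comp map_id.
- move=> x; rewrite /unzip2 -map_comp => /mapP[a aps ->] /=.
  have [i [j aE]] := in_grid_ordinals ps_kl aps; rewrite aE r_natE c_natE.
  by have := PM i j; rewrite !mxE -aE => /(_ aps).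
- rewrite /consistent /row_placement /col_placement -!map_comp.
  rewrite !allrel_mapl !allrel_mapr.
  apply/andP; split; apply/allrelP=> _ _ /(in_grid_ordinals ps_kl)[i [j ->]]
    /(in_grid_ordinals ps_kl)[i' [j' ->]]; rewrite /same_order /=.
  + by rewrite !r_natE !incr !eqxx.
  + by rewrite !c_natE !incc !eqxx.
Qed.

Lemma contains_of_placement G :
  spans_grid k l ps -> in_grid m n s ->
  unzip1 G = ps -> {subset unzip2 G <= s} -> consistent G ->
  contains (ones_mx k l ps) (ones_mx m n s).
Proof.
case/and3P=> _ /allP rowP /allP colP /allP s_mn GP Gs /andP[rowG colG].
have target_in_grid u : u \in G -> (u.2.1 < m) && (u.2.2 < n).
  by move=> uG; apply/s_mn/Gs/map_f.
have [| |r incr rE] := increasing_interpolation (m := k) (n := m) _ _ rowG.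
- by rewrite /unzip1 -map_comp (map_comp fst fst) -/(unzip1 G) GP.
- by move=> _ /mapP[_ /mapP[u /target_in_grid/andP[u1 _] ->] ->].
have [| |c incc cE] := increasing_interpolation (m := l) (n := n) _ _ colG.
- by rewrite /unzip1 -map_comp (map_comp snd fst) -/(unzip1 G) GP.
- by move=> _ /mapP[_ /mapP[u /target_in_grid/andP[_ u2] ->] ->].
apply/containsP; exists r, c; split=> // i j; rewrite !mxE -GP.
case/mapP=> -[ij [x y]] xyG /= ijE; rewrite -{}ijE in xyG.
have ix : (i : nat, x) \in row_placement G.
  by apply/mapP; exists ((i : nat, j : nat), (x, y)).
have jy : (j : nat, y) \in col_placement G.
  by apply/mapP; exists ((i : nat, j : nat), (x, y)).
by rewrite (rE _ _ ix) (cE _ _ jy); apply: Gs (map_f snd xyG).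
Qed.

End Placements.

(* [if] and not [&&], of which [vm_compute] evaluates both sides. *)
Fixpoint extendable (s : seq cell) (G : placement) (ps : seq cell) : bool :=
  if consistent G then
    if ps is a :: ps' then has (fun x => extendable s (rcons G (a, x)) ps') s
    else true
  else false.

Lemma extendableP s G ps :
  reflect (exists H, [/\ unzip1 H = ps, {subset unzip2 H <= s} &
                         consistent (G ++ H)])
          (extendable s G ps).
Proof.
elim: ps G => [|a ps IHps] G /=; rewrite -/(_ && _).
  rewrite andbT; apply: (iffP idP) => [consG|[[|u H] []//= _ _]].
    by exists [::]; rewrite cats0.
  by rewrite cats0.
apply: (iffP andP) => [[_ /hasP[x xs /IHps[H [HP Hs consGH]]]]|].
  exists ((a, x) :: H); split=> /= [|y|]; first by rewrite HP.
  - by rewrite inE => /predU1P[->|/Hs].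
  - by rewrite -cat_rcons.
case=> -[|[a' x] H] []//= [-> HP] Hs consGH; split.
  exact: consistent_catl consGH.
apply/hasP; exists x; first by apply: Hs; rewrite inE eqxx.
apply/IHps; exists H; split=> // [y yH|]; last by rewrite cat_rcons.
by apply: Hs; rewrite inE yH orbT.
Qed.

Lemma contains_ones_mx k l m n ps s :
  spans_grid k l ps -> in_grid m n s ->
  contains (ones_mx k l ps) (ones_mx m n s) = extendable s [::] ps.
Proof.
move=> ps_kl s_mn; apply/idP/extendableP => [|[G [GP Gs consG]]].
  by apply: placement_of_contains; case/andP: ps_kl.
exact: contains_of_placement GP Gs consG.
Qed.

Definition Q_cells : seq cell :=
  [:: (0, 1); (1, 4); (2, 2); (3, 0); (4, 3)].

Lemma Q_ones_mx : Q = ones_mx 5 5 Q_cells.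
Proof. by apply/matrixP=> i j; rewrite !mxE !inE !xpair_eqE !eqSS. Qed.

Lemma no_empty_line_Q : no_empty_line Q.
Proof. by rewrite Q_ones_mx; apply: no_empty_line_ones_mx. Qed.

Lemma contains_Q_ones_mx m n s :
  in_grid m n s -> contains Q (ones_mx m n s) = extendable s [::] Q_cells.
Proof. by rewrite Q_ones_mx; apply: contains_ones_mx. Qed.

(* Row 4 and column 4 are empty; like Q itself, the matrix is invariant under a
   quarter turn. It was found by computer search. *)
Definition Q_witness_cells : seq cell :=
  [:: (0, 2); (1, 5); (2, 3); (2, 8); (3, 1); (3, 6);
      (5, 2); (5, 7); (6, 0); (6, 5); (7, 3); (8, 6)].

Definition Q_witness : 'M[bool]_9 := ones_mx 9 9 Q_witness_cells.

Lemma contains_Q_set_entry_Q_witness i j :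
  contains Q (set_entry Q_witness i j) =
  extendable ((i : nat, j : nat) :: Q_witness_cells) [::] Q_cells.
Proof.
rewrite set_entry_ones_mx contains_Q_ones_mx //.
by rewrite /in_grid [all _ _]/= !ltn_ord.
Qed.

Lemma witness_Q :
  witness Q Q_witness (Ordinal (isT : 4 < 9)) (Ordinal (isT : 4 < 9)).
Proof.
pose has_Q_with x := extendable (x :: Q_witness_cells) [::] Q_cells.
split=> [|j|i].
- by rewrite /avoids contains_Q_ones_mx //; vm_compute.
- have /allP row4 : all (fun y => has_Q_with (4, y)) (iota 0 9) by vm_compute.
  by rewrite contains_Q_set_entry_Q_witness; apply: row4; rewrite mem_iota /=.
- have /allP col4 : all (fun x => has_Q_with (x, 4)) (iota 0 9) by vm_compute.
  by rewrite contains_Q_set_entry_Q_witness; apply: col4; rewrite mem_iota /=.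
Qed.

Theorem theorem3 (n : nat) (hn : 0 < n) : sat Q n n < 400.
Proof.
have [n_ge9|n_lt9] := leqP 9 n.
  have sat_le64 := sat_le_witness no_empty_line_Q witness_Q n_ge9 n_ge9.
  by apply: leq_ltn_trans sat_le64 _.
have Q_neq0 : exists a b, Q a b by exists ord0; apply: no_empty_line_Q.1.
by apply: leq_ltn_trans (sat_le_area n n Q_neq0) _; nia.
Qed.
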